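(* Let $d\in\mathbb{N}$ and let $(X,T)$ be a minimal system whose enveloping semigroup $E(X)$ is a $d$-step top-nilpotent group. For $k=1,\ldots,d$ and points $x,y\in X$, we have $(x,y)\in\mathbf{RP}^{[k]}(X)$ if and only if there is some element $p\in E_{k+1}^{\mathrm{top}}(X)$ with $y=px$.
   Context: A system $(X,T)$ is a compact metric space $(X,\rho)$ with a homeomorphism $T$; it is minimal if every orbit $\{T^nx:n\in\mathbb{Z}\}$ is dense. The enveloping semigroup $E(X)$ is the closure of $\{T^n:n\in\mathbb{Z}\}$ in $X^X$ with the product topology. Top-nilpotency: if $E=E(X)$ is a group, put $E_1^{\mathrm{top}}(X)=E$ and let $E_{j+1}^{\mathrm{top}}(X)$ be the closure of the subgroup $[E_j^{\mathrm{top}}(X),E]$ generated by the commutators $[a,b]=aba^{-1}b^{-1}$, $a\in E_j^{\mathrm{top}}(X)$, $b\in E$. $E$ is $d$-step top-nilpotent if $E_{d+1}^{\mathrm{top}}(X)$ is trivial. Regional proximality: for $k\in\mathbb{N}$, $(x,y)\in\mathbf{RP}^{[k]}(X)$ iff for every $\delta>0$ there exist $x',y'\in X$ and $\vec n\in\mathbb{Z}^k$ with $\rho(x,x')<\delta$, $\rho(y,y')<\delta$ and $\rho(T^{\vec n\cdot\epsilon}x',T^{\vec n\cdot\epsilon}y')<\delta$ for all $\epsilon\in\{0,1\}^k\setminus\{\vec 0\}$, where $\vec n\cdot\epsilon=\sum_i n_i\epsilon_i$. *)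

(* Defs.v *)
From HB Require Import structures.
From mathcomp Require Import all_boot all_order all_algebra.
From mathcomp Require Import all_classical all_reals all_analysis.

Set Implicit Arguments.
Unset Strict Implicit.
Unset Printing Implicit Defensive.

Import Order.TTheory GRing.Theory Num.Theory.

Local Open Scope classical_set_scope.
Local Open Scope ring_scope.

Record homeomorphism (X : topologicalType) := Homeomorphism {
  hfun :> X -> X;
  hinv : X -> X;
  hfunK : cancel hfun hinv;
  hinvK : cancel hinv hfun;
  hfun_continuous : continuous hfun;
  hinv_continuous : continuous hinv }.

Definition hpow (X : topologicalType) (T : homeomorphism X) (n : int) : X -> X :=
  match n with
  | Posz m => iter m T
  | Negz m => iter m.+1 (hinv T)
  end.

Definition minimal_system (X : topologicalType) (T : homeomorphism X) : Prop :=
  forall x : X, dense (range (fun n : int => hpow T n x)).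

Definition enveloping (X : topologicalType) (T : homeomorphism X) :
    set {ptws X -> X} :=
  closure (range (hpow T : int -> {ptws X -> X})).

(* A semigroup of self-maps that contains the identity map, as the enveloping
   semigroup does, can only be a group with the identity map as unit. *)
Definition composition_group (X : Type) (G : set (X -> X)) : Prop :=
  [/\ G id,
      forall p q, G p -> G q -> G (p \o q) &
      forall p, G p -> exists q, [/\ G q, p \o q = id & q \o p = id]].

(* The maps a', b' are the inverses of a, b. *)
Definition commutators (X : Type) (A B : set (X -> X)) : set (X -> X) :=
  [set c | exists a a' b b' : X -> X,
    [/\ A a, B b, cancel a a' /\ cancel a' a, cancel b b' /\ cancel b' b &
        c = a \o b \o a' \o b']].

Definition commutator_subgroup (X : Type) (A B : set (X -> X)) :
    set (X -> X) :=
  smallest (@composition_group X) (commutators A B).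

(* Indexed from 1; the value at j = 0 is a dummy, equal to the one at j = 1. *)
Definition Etop (X : topologicalType) (T : homeomorphism X) (j : nat) :
    set {ptws X -> X} :=
  iter j.-1
    (fun A : set {ptws X -> X} =>
       closure (commutator_subgroup A (enveloping T) : set {ptws X -> X}))
    (enveloping T).

Definition top_nilpotent_group (X : topologicalType) (T : homeomorphism X)
    (d : nat) : Prop :=
  composition_group (enveloping T) /\ Etop T d.+1 = [set id].

Definition RP (R : realType) (X : metricType R) (T : homeomorphism X)
    (k : nat) : set (X * X) :=
  [set xy | forall delta : R, 0 < delta ->
    exists (x' y' : X) (n : 'I_k -> int),
      [/\ mdist xy.1 x' < delta, mdist xy.2 y' < delta &
          forall e : {ffun 'I_k -> bool}, e != [ffun=> false] ->
            let m := \sum_(i < k) n i * (e i)%:Z in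
            mdist (hpow T m x') (hpow T m y') < delta]].

(* Main.v *)
Require Import Defs.
From HB Require Import structures.
From mathcomp Require Import all_boot all_order all_algebra.
From mathcomp Require Import all_classical all_reals all_analysis.
Local Open Scope classical_set_scope.

(* Let G be the closure, in (X^X)^({0,1}^k), of the tuples (T^(a + m.e))_e. As
   E is a group, so is G by Ellis' argument, and the space Q of the points
   g(x0,...,x0), g in G, is homogeneous under G.

   If p lies in E_{k+1}, commutators of face maps show that the tuple equal to
   p at the vertex 1 and to the identity elsewhere lies in the group G of
   dimension k+1; reading this at (x,...,x) gives (x, px) in RP^[k].

   Conversely, the map w |-> closure of {(T^t w_e)_e : t} is lower
   semicontinuous, so by Baire category it is continuous, for the faces of all
   dimensions, at some w in Q. At such a w, opposite faces are exchanged by an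
   element of E, and every z such that (w, z) is a limit of parallelepipeds of
   dimension k+1 is of the form z = pw with p in E. A pair (x, y) in RP^[k] can
   be moved by G so that z differs from w at the vertex 1 only, where they are
   hx and hy; then p fixes w_e for e <> 1, and taking commutators of p with
   the k translations of w gives hy = u(hx) for some u in E_{k+1}. *)

Set Implicit Arguments.
Unset Strict Implicit.
Unset Printing Implicit Defensive.

Import Order.TTheory GRing.Theory Num.Theory.

Local Open Scope ring_scope.

(** * The topology of pointwise convergence *)

Lemma ptws_eval_continuous (I : eqType) (Y : topologicalType) (i : I) :
  continuous (fun f : {ptws I -> Y} => f i).
Proof. exact: (@proj_continuous I (fun=> Y) i). Qed.

Lemma cvg_ptws (Y : topologicalType) (I : Type) (F : set_system {ptws I -> Y})
    (f : {ptws I -> Y}) : Filter F ->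
  (forall i, (fun g => g i) @ F --> f i) -> F --> f.
Proof.
move=> FF Ff; apply/cvg_sup => i A /= [_ [[B oB <-] Bf] sBA].
by apply: filterS sBA _; apply: (Ff i B); exact: open_nbhs_nbhs.
Qed.

Lemma continuous_ptws (S Y : topologicalType) (I : Type)
    (f : S -> {ptws I -> Y}) :
  (forall i, continuous (fun s => f s i)) -> continuous f.
Proof. by move=> cf s; apply: cvg_ptws => i; exact: (cf i s). Qed.

Lemma compact_ptws (I : eqType) (Y : topologicalType) :
  compact [set: Y] -> compact [set: {ptws I -> Y}].
Proof.
move=> cY; have := @tychonoff I (fun=> Y) (fun=> setT) (fun=> cY).
by congr compact; apply/seteqP; split.
Qed.

Lemma hausdorff_ptws (I : eqType) (Y : topologicalType) :
  hausdorff_space Y -> hausdorff_space {ptws I -> Y}.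
Proof. by move=> hY; exact: (@hausdorff_product I (fun=> Y)). Qed.

Lemma closed_image (S Y : topologicalType) (f : S -> Y) (A : set S) :
  hausdorff_space Y -> continuous f -> compact A -> closed (f @` A).
Proof.
move=> hY cf cA; apply: compact_closed => //.
by apply: continuous_compact => //; exact: continuous_subspaceT.
Qed.

(** The density argument used throughout: a closed condition checked on [A] passes to the closure of
    [A]. *)
Lemma closure_preimage (S Y : topologicalType) (f : S -> Y) (A : set S)
    (B : set Y) : continuous f -> A `<=` f @^-1` closure B ->
  closure A `<=` f @^-1` closure B.
Proof.
move=> cf AB; have /continuous_closedP/(_ _ (@closed_closure _ B)) := cf.
by move=> /closure_id ->; exact: closureS.
Qed.

(** * The enveloping semigroup and its lower central series *)

Section Ellis.
Variables (M : topologicalType) (op : M -> M -> M) (e : M) (S : set M).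
Hypotheses (hM : hausdorff_space M) (cS : compact S) (S0 : S !=set0).
Hypothesis op_continuous : forall q, S q -> continuous (op^~ q).
Hypothesis opA : forall a b c, op a (op b c) = op (op a b) c.
Hypothesis opS : forall a b, S a -> S b -> S (op a b).
Hypothesis op1 : forall a, op a e = a.
(** In the uses below, the elements of [S] are invertible in a larger family of maps, which gives
    this cancellation; the point is that their inverses stay in [S]. *)
Hypothesis opI : forall a b, S a -> S b -> op a b = b -> a = e.

Let left_ideal (L : set M) := [/\ closed L, L !=set0 &
  forall a b, S a -> L b -> L (op a b)].

(* A minimal closed left ideal L satisfies L s = L for s in L, so by opI it
   contains e and is everything. *)
Lemma compact_semigroup_inverse s : S s -> exists2 t, S t & op t s = e.
Proof.
have clS : closed S by exact: compact_closed.
have idI L (a b : M) : left_ideal (S `\` L) -> S a -> S b -> ~ L b ->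
  S (op a b) /\ ~ L (op a b) by move=> [_ _ h] Sa Sb nLb; exact: h.
(* Zorn's lemma yields maximal sets for unions of chains, so it is applied to sets whose complement
   in [S] is a left ideal; L is the complement of [A] in [S]. For a nonempty chain, compactness
   gives a point common to all the ideals. *)
have [F FP Ftot|A [[clL [z [Sz nAz]] idL] Amax]] :=
    @Zorn_bigcup M [set U | left_ideal (S `\` U)].
  have [->|/set0P[U0 FU0]] := eqVneq F set0.
    by rewrite bigcup_set0; split; rewrite ?setD0// => a b; exact: opS.
  pose G := filter_from F (fun U => S `\` U).
  have PG : ProperFilter G.
    apply: filter_from_proper; last by move=> U /FP[].
    apply: filter_from_filter; first by exists U0.
    move=> U V FU FV; have [UV|VU] := Ftot _ _ FU FV.
    - by exists V => // a [Sa nVa]; split; split => // /UV.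
    - by exists U => // a [Sa nUa]; split; split => // /VU.
  have GS : G S by exists U0 => // a [].
  have [p [Sp clp]] := cS PG GS.
  have np U : F U -> (S `\` U) p.
    move=> FU; have [cl _ _] := FP _ FU; apply: cl => B pB.
    by apply: clp => //; exists U.
  split.
  - rewrite (_ : _ `\` _ = \bigcap_(U in F) (S `\` U)).
      by apply: closed_bigI => U /FP[].
    apply/seteqP; split=> [a [Sa na] U FU|a h].
      by split => // Ua; apply: na; exists U.
    by split; [have [] := h _ FU0|move=> [U FU Ua]; have [] := h _ FU].
  - by exists p; split => // -[U FU Up]; have [] := np _ FU.
  - move=> a b Sa [Sb nb]; split; first exact: opS.
    move=> [U FU Uab]; have [] := idI U a b (FP _ FU) Sa Sb => //.
    by move=> Ub; apply: nb; exists U.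
(* For [b] in L the set L b is a closed left ideal inside L, so by minimality it contains L. *)
have LE b : S b -> ~ A b -> S `\` A `<=` (op^~ b) @` (S `\` A).
  move=> Sb nAb c [Sc nAc].
  have [//|nLc] := pselect (((op^~ b) @` (S `\` A)) c).
  exfalso; apply: (Amax (A `|` ~` ((op^~ b) @` (S `\` A)))).
    by split; [left|move=> /(_ c) h; apply/nAc/h; right].
  rewrite /=; have -> : S `\` (A `|` ~` ((op^~ b) @` (S `\` A))) =
      (op^~ b) @` (S `\` A).
    apply/seteqP; split=> [a [_ na]|_ [a [Sa nAa] <-]].
      by apply: contrapT => h; apply: na; right.
    have [? ?] := idL a b Sa (conj Sb nAb); split => // -[//|]; apply.
    by exists a.
  split.
  - apply: closed_image => //; first exact: op_continuous.
    exact: (subclosed_compact clL cS).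
  - by exists (op b b), b.
  - move=> a _ Sa [d [Sd nAd] <-]; exists (op a d); last by rewrite opA.
    exact: idL.
have nAe : S e /\ ~ A e.
  have [d [Sd nAd] dz] := LE _ Sz nAz _ (conj Sz nAz).
  by rewrite -(opI Sd Sz dz).
move=> Ss; have nAs : ~ A s by have [] := idL s e Ss nAe; rewrite op1.
by have [t [St _] ts] := LE s Ss nAs _ nAe; exists t.
Qed.
End Ellis.

Section Hpow.
Variables (X : topologicalType) (T : homeomorphism X).

Lemma hpow_succ n : hpow T (1 + n) = T \o hpow T n.
Proof.
case: n => [n|[|n]].
- by [].
- by apply/funext => x /=; rewrite hinvK.
- have -> : 1 + Negz n.+1 = Negz n by rewrite !NegzE (intS n.+1) opprD addNKr.
  by apply/funext => x /=; rewrite hinvK.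
Qed.

Lemma hpow_pred n : hpow T (- 1 + n) = hinv T \o hpow T n.
Proof.
rewrite -{2}(addKr (- 1) n) opprK hpow_succ.
by apply/funext => x /=; rewrite hfunK.
Qed.

Lemma hpowD m n : hpow T (m + n) = hpow T m \o hpow T n.
Proof.
elim/int_rect: m => [|m IH|m IH]; first by rewrite add0r.
- by rewrite intS -addrA !hpow_succ IH.
- by rewrite intS opprD -addrA !hpow_pred IH.
Qed.

Lemma hpowC m n : hpow T m \o hpow T n = hpow T n \o hpow T m.
Proof. by rewrite -!hpowD addrC. Qed.

Lemma hpow_continuous n : continuous (hpow T n).
Proof.
elim/int_rect: n => [|n IH|n IH] x; first exact: cvg_id.
- rewrite intS hpow_succ; apply: continuous_comp; first exact: IH.
  exact: hfun_continuous.
- rewrite intS opprD hpow_pred; apply: continuous_comp; first exact: IH.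
  exact: hinv_continuous.
Qed.

End Hpow.

Lemma comp_continuousl (Z : Type) (W : eqType) (Y : topologicalType)
    (q : Z -> W) :
  continuous (fun p : {ptws W -> Y} => p \o q : {ptws Z -> Y}).
Proof. by apply: continuous_ptws => z; exact: ptws_eval_continuous. Qed.

Lemma comp_continuousr (W : eqType) (Y Z : topologicalType) (f : Y -> Z) :
  continuous f ->
  continuous (fun p : {ptws W -> Y} => f \o p : {ptws W -> Z}).
Proof.
move=> cf; apply: continuous_ptws => w p.
by apply: (@continuous_comp _ _ _ (fun p : {ptws W -> Y} => p w) f);
  [exact: ptws_eval_continuous|exact: cf].
Qed.

(** The smallest group is an intersection of groups. [G] supplies a candidate inverse, and
    uniqueness of two-sided inverses puts it in every other group of the intersection. *)
Lemma commutator_subgroup_group (X : Type) (A B G : set (X -> X)) :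
  composition_group G -> commutators A B `<=` G ->
  composition_group (commutator_subgroup A B).
Proof.
move=> gG ABG; split.
- by move=> H [[]].
- move=> p q Hp Hq H HH; have [[_ + _] _] := HH.
  by apply; [exact: Hp|exact: Hq].
- move=> p Hp; have [_ _ /(_ p)] := gG.
  move=> /(_ (Hp G (conj gG ABG))) [q [Gq pq qp]]; exists q; split => // H HH.
  have [[_ _ /(_ _ (Hp H HH)) [r [Hr pr rp]]] _] := HH.
  suff -> : q = r by [].
  by rewrite -[r]/(id \o r) -qp -compA pr.
Qed.

Section Enveloping.
Variables (X : topologicalType) (T : homeomorphism X).
Hypotheses (cX : compact [set: X]) (hX : hausdorff_space X).
Let P := {ptws X -> X}.
Let E : set P := enveloping T.
Hypothesis gE : composition_group E.

(** The invariant of the induction along the lower central series; closedness keeps the next term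
    inside the present one. *)
Definition normal_subgroup (A : set P) :=
  [/\ A `<=` E, closed A, composition_group A &
   forall p q q', A p -> E q -> cancel q q' -> cancel q' q -> A (q \o p \o q')].

Lemma enveloping_compact : compact E.
Proof.
apply: (subclosed_compact (@closed_closure _ _) (compact_ptws cX)) => //.
Qed.

Lemma group_inverse (G : set P) p : composition_group G -> G p ->
  exists q, [/\ G q, cancel p q & cancel q p].
Proof.
move=> [_ _ gi] /gi [q [Gq pq qp]]; exists q; split => // x.
- by move/(congr1 (@^~ x)) : qp.
- by move/(congr1 (@^~ x)) : pq.
Qed.

Lemma subgroup_inverse (A : set P) p q : composition_group A -> A p ->
  cancel p q -> cancel q p -> A q.
Proof.
move=> gA Ap pq qp; have [r [Ar pr rp]] := group_inverse gA Ap.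
by rewrite (_ : q = r) //; apply/funext => x; rewrite -{1}(rp x) pq.
Qed.

Let D A := closure (commutator_subgroup A E : set P).

Section Step.
Variable A : set P.
Hypothesis nA : normal_subgroup A.
Let H : set P := commutator_subgroup A E.

Let AE : A `<=` E. Proof. by case: nA. Qed.
Let gA : composition_group A. Proof. by case: nA. Qed.

Let commA : commutators A E `<=` A.
Proof.
move=> _ [a [a' [b [b' [Aa Eb [aa' a'a] [bb' b'b] ->]]]]].
have [_ _ [_ gAm _] nrm] := nA.
apply: (gAm a (b \o a' \o b')) => //; apply: nrm => //.
exact: (subgroup_inverse gA Aa).
Qed.

Let gH : composition_group H.
Proof. exact: (commutator_subgroup_group gA). Qed.

Let HA : H `<=` A. Proof. by move=> p; apply. Qed.

Let DA : D A `<=` A.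
Proof.
have [_ /closure_id clA _ _] := nA.
by rewrite [X in _ `<=` X]clA; exact: closureS.
Qed.

Let commH p q p' q' : A p -> E q -> cancel p p' -> cancel p' p ->
  cancel q q' -> cancel q' q -> H (p \o q \o p' \o q').
Proof. by move=> Ap Eq *; move=> G [_]; apply; exists p, p', q, q'; split. Qed.

Let HM p q : H p -> H q -> H (p \o q).
Proof. by case: gH => _ + _; exact. Qed.

Let commV p q p' q' : A p -> E q -> cancel p p' -> cancel p' p ->
  cancel q q' -> cancel q' q -> H (q \o p \o q' \o p').
Proof.
move=> Ap Eq pp' p'p qq' q'q.
apply: (subgroup_inverse gH (commH Ap Eq pp' p'p qq' q'q)) => x /=.
  by rewrite pp' qq' p'p q'q.
by rewrite qq' pp' q'q p'p.
Qed.

(** A conjugate of [p] is the commutator of [q] and [p] times [p], and this commutator lies in [H]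
    because [p] lies in [A]. *)
Let HN p q q' : H p -> E q -> cancel q q' -> cancel q' q -> H (q \o p \o q').
Proof.
move=> Hp Eq qq' q'q; have [p' [Hp' pp' p'p]] := group_inverse gH Hp.
rewrite (_ : _ \o _ = (q \o p \o q' \o p') \o p).
  by apply: HM => //; apply: commV => //; exact: HA.
by apply/funext => x /=; rewrite pp'.
Qed.

Let DH p q : D A p -> H q -> D A (p \o q).
Proof.
move=> Dp Hq; move: p Dp; apply: closure_preimage.
  exact: comp_continuousl.
by move=> p Hp; apply: subset_closure; exact: HM.
Qed.

(* Only right multiplications are continuous on E, so left multiplication by H
   is rewritten as p q = q (q^-1 p q) with q^-1 p q in H. *)
Let HD p q : H p -> D A q -> D A (p \o q).
Proof.
move=> Hp Dq; have [q' [Eq' qq' q'q]] := group_inverse gE (AE (DA Dq)).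
rewrite (_ : _ \o _ = q \o (q' \o p \o q)); last first.
  by apply/funext => x /=; rewrite q'q.
by apply: DH => //; exact: HN.
Qed.

Let DM p q : D A p -> D A q -> D A (p \o q).
Proof.
move=> + Dq; move: p; apply: closure_preimage; first exact: comp_continuousl.
by move=> p Hp; exact: HD.
Qed.

(** Inversion on E is not known to be continuous, so inverses come from Ellis' argument. Conjugates
    are treated as in [HN], with [HD] for the product. *)
Lemma commutator_closure_normal : normal_subgroup (D A).
Proof.
have DE : D A `<=` E by apply: subset_trans AE.
split => //; first exact: closed_closure.
  have cD : compact (D A).
    exact: (subclosed_compact (@closed_closure _ _) enveloping_compact).
  have D1 : D A id by apply: subset_closure; case: gH.
  split => // p Dp; have [q [Eq pq qp]] := group_inverse gE (DE _ Dp).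
  have [||r Dr rp] :=
    @compact_semigroup_inverse P (fun p q => p \o q) id (D A)
     (hausdorff_ptws hX) cD (ex_intro _ _ D1) _ (fun _ _ _ => erefl) DM
     (fun _ => erefl) _ p Dp.
  - by move=> r _; exact: comp_continuousl.
  - move=> a b _ Db ab; have [b' [_ bb' b'b]] := group_inverse gE (DE _ Db).
    apply/funext => x; rewrite -{1}(b'b x).
    by move/(congr1 (@^~ (b' x))) : ab => /= ->.
  have rq : r = q.
    by apply/funext => x; rewrite -{1}(qp x); move/(congr1 (@^~ (q x))) : rp.
  by exists q; split; [rewrite -rq|apply/funext|apply/funext].
move=> p q q' Dp Eq qq' q'q.
have [p' [Ep' pp' p'p]] := group_inverse gE (DE _ Dp).
rewrite (_ : _ \o _ = (q \o p \o q' \o p') \o p).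
  by apply: HD => //; apply: commV => //; exact: DA.
by apply/funext => x /=; rewrite pp'.
Qed.

End Step.

Lemma enveloping_normal : normal_subgroup E.
Proof.
split => //; first exact: closed_closure.
have [_ gEm _] := gE; move=> p q q' Ep Eq qq' q'q.
by apply: (gEm _ q'); [exact: gEm|exact: (subgroup_inverse gE Eq)].
Qed.

Lemma Etop_normal j : normal_subgroup (Etop T j).
Proof.
rewrite /Etop; elim: j.-1 => [|i IH]; first exact: enveloping_normal.
exact: commutator_closure_normal.
Qed.

Lemma Etop_comm j p q p' q' : Etop T j.+1 p -> E q -> cancel p p' ->
  cancel p' p -> cancel q q' -> cancel q' q ->
  Etop T j.+2 (p \o q \o p' \o q').
Proof.
by move=> *; apply: subset_closure => G [_]; apply; exists p, p', q, q'; split.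
Qed.
End Enveloping.

(** * The group of parallelepipeds *)

Section Cubes.
Variables (X : topologicalType) (T : homeomorphism X).
Hypotheses (cX : compact [set: X]) (hX : hausdorff_space X).
Let P := {ptws X -> X}.
Let E : set P := enveloping T.
Hypothesis gE : composition_group E.
Variable k : nat.
Let V := {ffun 'I_k -> bool}.
Let C := {ptws V -> {ptws X -> X}}.

Definition cube_exponent (a : int) (m : 'I_k -> int) (e : V) : int :=
  a + \sum_(l < k) m l * (e l)%:Z.

Definition parallelepipeds : set C :=
  [set g | exists a m, g = fun e => hpow T (cube_exponent a m e)].

(** This is the enveloping semigroup of the action on X^V generated by the diagonal transformation
    and those of the facets e_l = 1, each map being recorded by its coordinates. *)
Definition cube_group : set C := closure parallelepipeds.

Definition cube_comp (g h : C) : C := fun e => g e \o h e.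

Lemma cube_group_coord g e : cube_group g -> E (g e).
Proof.
have cg : continuous (fun g : C => g e) by exact: ptws_eval_continuous.
move: g; apply: (closure_preimage cg) => _ [a [m ->]].
by apply: subset_closure; exists (cube_exponent a m e).
Qed.

Lemma cube_comp_continuousl h : continuous (cube_comp^~ h).
Proof.
apply: continuous_ptws => e g.
apply: (@continuous_comp _ _ _ (fun g : C => g e)
  (fun p : P => p \o h e : P)).
  exact: ptws_eval_continuous.
exact: comp_continuousl.
Qed.

Lemma cube_comp_continuousr g : parallelepipeds g -> continuous (cube_comp g).
Proof.
move=> [a [m ->]]; apply: continuous_ptws => e h.
apply: (@continuous_comp _ _ _ (fun g : C => g e)
  (fun p : P => hpow T (cube_exponent a m e) \o p : P)).
  exact: ptws_eval_continuous.
by apply: comp_continuousr; exact: hpow_continuous.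
Qed.

(** The limit in the left factor comes first, with [h] fixed. The remaining [g] is a parallelepiped
    of powers of T, by which left multiplication is continuous, so the limit in [h] can follow. *)
Lemma cube_groupM g h : cube_group g -> cube_group h ->
  cube_group (cube_comp g h).
Proof.
move=> + Gh; move: g; apply: closure_preimage.
  exact: cube_comp_continuousl.
move=> g Gg; move: h Gh; apply: closure_preimage.
  exact: cube_comp_continuousr.
move=> h Gh; apply: subset_closure.
move: Gg Gh => [a [m ->]] [b [n ->]]; exists (a + b), (fun l => m l + n l).
apply/funext => e; rewrite /cube_comp -hpowD; congr (hpow T).
rewrite /cube_exponent addrACA -big_split; congr (_ + _).
by apply: eq_bigr => l _; rewrite mulrDl.
Qed.

Lemma cube_group_diag p : E p -> cube_group (fun=> p).
Proof.
move: p; apply: (@closure_preimage _ C (fun p : P => (fun=> p) : C)).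
  by apply: continuous_ptws => e p; exact: cvg_id.
move=> _ [n _ <-]; apply: subset_closure; exists n, (fun=> 0).
by apply/funext => e;
  rewrite /cube_exponent big1 ?addr0// => l _; rewrite mul0r.
Qed.

Lemma cube_group1 : cube_group (fun=> id).
Proof. by apply: cube_group_diag; case: gE. Qed.

Lemma cube_groupV g : cube_group g -> exists h, cube_group h /\
  forall e, cancel (g e) (h e) /\ cancel (h e) (g e).
Proof.
move=> Gg.
have cG : compact cube_group.
  apply: (subclosed_compact (@closed_closure _ _) (compact_ptws _)) => //.
  exact: compact_ptws.
have [|||h Gh hg] := @compact_semigroup_inverse C cube_comp (fun=> id)
  cube_group _ cG (ex_intro _ _ cube_group1) _ (fun _ _ _ => erefl)
  cube_groupM (fun _ => erefl) _ g Gg.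
- by apply: hausdorff_ptws; exact: hausdorff_ptws.
- by move=> r _; exact: cube_comp_continuousl.
- move=> a b _ Gb ab; apply/funext => e.
  have [b' [_ bb' b'b]] := group_inverse gE (@cube_group_coord _ e Gb).
  apply/funext => x; rewrite -{1}(b'b x).
  by move/(congr1 (fun g : C => g e (b' x))) : ab; rewrite /cube_comp /= b'b.
exists h; split => // e.
have hge : cancel (g e) (h e).
  by move=> x; move/(congr1 (fun g : C => g e x)) : hg.
split => // x.
have [q [_ gq qg]] := group_inverse gE (@cube_group_coord _ e Gg).
by rewrite -{1}(qg x) hge qg.
Qed.

(** For [i <= k], a face of codimension [i]: the whole cube for [i = 0], the vertex 1 for
    [i = k]. *)
Definition upper_face (i : nat) (e : V) :=
  [forall l : 'I_k, (l < i)%N ==> e l].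

Definition on_face (F : pred V) (p : X -> X) : C :=
  fun e => if F e then p else id.

Lemma cube_group_facet (l : 'I_k) p : E p ->
  cube_group (on_face (fun e => e l) p).
Proof.
move: p; apply: (@closure_preimage _ C (fun p : P => on_face (fun e => e l) p)).
  apply: continuous_ptws => e; rewrite /on_face; case: (e l) => p.
    exact: cvg_id.
  exact: (@cst_continuous P P).
move=> _ [n _ <-]; apply: subset_closure.
exists 0, (fun i => if i == l then n else 0).
apply/funext => e; rewrite /cube_exponent add0r (bigD1 l)//= eqxx big1.
  by rewrite addr0 /on_face; case: (e l); rewrite ?mulr1 ?mulr0.
by move=> i /negbTE ->; rewrite mul0r.
Qed.

Let S F : set P := [set p | E p /\ cube_group (on_face F p)].

(** Being a group, [S F] contains the whole commutator subgroup as soon as it contains the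
    commutators. *)
Let on_face_group F : composition_group (S F).
Proof.
have [E1 EM _] := gE; split.
- split => //; rewrite (_ : on_face _ _ = fun=> id); first exact: cube_group1.
  by apply/funext => e; rewrite /on_face; case: ifP.
- move=> p q [Ep Gp] [Eq Gq]; split; first exact: EM.
  rewrite (_ : on_face _ _ = cube_comp (on_face F p) (on_face F q)).
    exact: cube_groupM.
  by apply/funext => e; rewrite /cube_comp /on_face; case: ifP.
- move=> p [Ep Gp]; have [q [Eq pq qp]] := group_inverse gE Ep.
  exists q; split; [split => // |exact/funext|exact/funext].
  have [h [Gh gh]] := cube_groupV Gp.
  rewrite (_ : on_face _ _ = h) //; apply/funext => e; apply/funext => x.
  have [] := gh e; rewrite /on_face; case: ifP => _ ph hp.
    by rewrite -{1}(hp x) pq.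
  by rewrite -{1}(hp x).
Qed.

Lemma cube_group_face i p : (i <= k)%N -> Etop T i p ->
  cube_group (on_face (upper_face i) p).
Proof.
have facet0 q (k0 : (0 < k)%N) : E q -> cube_group (on_face (upper_face 1) q).
  move=> Eq; rewrite (_ : upper_face 1 = fun e => e (Ordinal k0)).
    exact: cube_group_facet.
  apply/funext => e; apply/forallP/idP => [/(_ (Ordinal k0))//|e0 l].
  apply/implyP; rewrite ltnS leqn0 => /eqP l0.
  by rewrite (_ : l = Ordinal k0) //; exact/val_inj.
(* Two base cases, since [Etop T 0] and [Etop T 1] are both E: the whole cube and the first
   facet. *)
elim: i p => [p _ Ep|[|i] IH p ik].
- rewrite (_ : on_face _ _ = fun=> p); first exact: cube_group_diag.
  apply/funext => e; rewrite /on_face (_ : upper_face _ _) //.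
  by apply/forallP.
- exact: facet0.
move: p; apply: (@closure_preimage _ C
  (fun p : P => on_face (upper_face i.+2) p)).
  apply: continuous_ptws => e; rewrite /on_face; case: (upper_face _ _) => p.
    exact: cvg_id.
  exact: (@cst_continuous P P).
suff H : commutator_subgroup (Etop T i.+1) E `<=` S (upper_face i.+2).
  by move=> p /H [].
apply: smallest_sub; first exact: on_face_group.
move=> _ [p [p' [q [q' [Ap Eq [pp' p'p] [qq' q'q] ->]]]]].
have [AE _ gA _] := Etop_normal cX hX gE i.+1.
have Ap' := subgroup_inverse gA Ap pp' p'p.
have Eq' := subgroup_inverse gE Eq qq' q'q.
have [_ EM _] := gE.
split; first exact: EM (EM _ _ (EM _ _ (AE _ Ap) Eq) (AE _ Ap')) Eq'.
(* The facet of this coordinate, of index i + 1, cuts [upper_face i.+2] out of [upper_face i.+1].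
   The commutator of a map on the one with a map on the other is the identity off the
   intersection. *)
pose l := Ordinal ik.
have Fl r : E r -> cube_group (on_face (fun e => e l) r).
  exact: cube_group_facet.
have Fi r : Etop T i.+1 r -> cube_group (on_face (upper_face i.+1) r).
  by apply: IH; exact: ltnW.
rewrite (_ : on_face _ _ = cube_comp (cube_comp (cube_comp
  (on_face (upper_face i.+1) p) (on_face (fun e => e l) q))
  (on_face (upper_face i.+1) p')) (on_face (fun e => e l) q')).
  by apply: cube_groupM; [apply: cube_groupM; [apply: cube_groupM|]|];
    auto.
apply/funext => e; apply/funext => x; rewrite /cube_comp /on_face /=.
have -> : upper_face i.+2 e = upper_face i.+1 e && e l.
  apply/forallP/andP => [h|[/forallP h el] j].
    split; last by have := h l; rewrite ltnSn.
    apply/forallP => j; apply/implyP => ji.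
    by have /implyP := h j; apply; exact: ltnW.
  apply/implyP; rewrite ltnS leq_eqVlt => /predU1P[ji|ji].
    by rewrite (_ : j = l) //; exact/val_inj.
  by have /implyP := h j; exact.
by case: (upper_face _ _); case: (e l) => //=; rewrite ?q'q ?p'p.
Qed.

End Cubes.

Lemma cube_group_approx (X : topologicalType) (T : homeomorphism X) k
    (g : {ptws {ffun 'I_k -> bool} -> {ptws X -> X}})
    (N : {ffun 'I_k -> bool} -> set {ptws X -> X}) :
  cube_group T g -> (forall e, nbhs (g e) (N e)) ->
  exists a m, forall e, N e (hpow T (cube_exponent a m e)).
Proof.
move=> Gg gN.
have : nbhs g (fun h => forall e, N e (h e)).
  apply: (filter_forall (nbhs_filter g)) => e.
  exact: (@ptws_eval_continuous _ {ptws X -> X} e g (N e) (gN e)).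
by move=> /Gg[_ [[a [m ->]] aN]]; exists a, m.
Qed.

(** * From the lower central series to regional proximality *)

Section FaceElements.
Variables (R : realType) (X : metricType R) (T : homeomorphism X).
Hypothesis cX : compact [set: X].
Hypothesis gE : composition_group (enveloping T).

Lemma nbhs_ptws_ball (p : {ptws X -> X}) (x : X) (r : R) : 0 < r ->
  nbhs p [set q : {ptws X -> X} | mdist (p x) (q x) < r].
Proof.
move=> r0; apply: (@ptws_eval_continuous _ X x p [set y | mdist (p x) y < r]).
by rewrite -ballEmdist; exact: nbhsx_ballx.
Qed.

(* The vertex of {0,1}^(k+1) with first coordinate b and the others flipped:
   the inequality in RP omits the vertex 0, whereas p acts at the vertex 1. *)
Definition flip_cons k (b : bool) (e : {ffun 'I_k -> bool}) :
    {ffun 'I_k.+1 -> bool} :=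
  [ffun l => if unlift ord0 l is Some i then ~~ e i else b].

(** Replacing e_i by 1 - e_i negates the slopes and moves the base point; only the term in [b]
    separates the two facets, which are translates of each other. *)
Lemma cube_exponent_flip_cons k a (m : 'I_k.+1 -> int) b e :
  cube_exponent a m (flip_cons b e) =
  \sum_(i < k) - m (lift ord0 i) * (e i)%:Z +
    (m ord0 * b%:Z + cube_exponent a (m \o lift ord0) [ffun=> true]).
Proof.
rewrite /cube_exponent big_ord_recl ffunE unlift_none addrCA [RHS]addrCA.
congr (_ + _); rewrite addrCA; congr (_ + _); rewrite -big_split.
apply: eq_bigr => i _; rewrite !ffunE liftK /=.
by case: (e i); rewrite ?mulr1 ?mulr0 ?addNr ?add0r.
Qed.

(** A parallelepiped of powers of T close to [p] at the vertex 1 and to the identity elsewhere, read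
    at x, splits into the facets [b = false] and [b = true]. At [e = 0] they give x' and y', close
    to x and px; at every other [e] both are close to x. *)
Lemma Etop_RP k x p : Etop T k.+1 p -> RP T k (x, p x).
Proof.
move=> Ep d d0; have hX := @metric_hausdorff R X.
have [a [m am]] := @cube_group_approx X T k.+1
  (on_face (upper_face k.+1) p)
  (fun e =>
    [set q | mdist (on_face (@upper_face k.+1 k.+1) p e x) (q x) < d / 2])
  (cube_group_face cX hX gE (leqnn _) Ep)
  (fun e => nbhs_ptws_ball _ _ (divr_gt0 d0 (ltr0n _ 2))).
pose c (b : bool) :=
  m ord0 * b%:Z + cube_exponent a (m \o lift ord0) [ffun=> true].
have ce b e : cube_exponent a m (flip_cons b e) =
    \sum_(i < k) - m (lift ord0 i) * (e i)%:Z + c b.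
  exact: cube_exponent_flip_cons.
have face b (e : {ffun 'I_k -> bool}) :
    upper_face k.+1 (flip_cons b e) = b && (e == [ffun=> false]).
  apply/forallP/andP => [h|[-> /eqP ->] l].
    have /implyP/(_ (ltn_ord _)) := h ord0; rewrite ffunE unlift_none => ->.
    split => //; apply/eqP/ffunP => i.
    have /implyP/(_ (ltn_ord _)) := h (lift ord0 i).
    by rewrite !ffunE liftK => /negbTE.
  by apply/implyP => _; rewrite ffunE; case: unlift => // i; rewrite ffunE.
have near b (e : {ffun 'I_k -> bool}) :
    mdist (if b && (e == [ffun=> false]) then p x else x)
      (hpow T (\sum_(i < k) - m (lift ord0 i) * (e i)%:Z) (hpow T (c b) x)) <
    d / 2.
  have := am (flip_cons b e); rewrite /on_face /= face ce hpowD /=.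
  by case: ifP.
have d2 : d / 2 < d by rewrite ltr_pdivrMr// ltr_pMr// ltr1n.
have sum0 : \sum_(i < k) - m (lift ord0 i) * ([ffun=> false] i)%:Z = 0.
  by rewrite big1// => i _; rewrite ffunE mulr0.
exists (hpow T (c false) x), (hpow T (c true) x), (fun i => - m (lift ord0 i)).
split.
- by have := near false [ffun=> false]; rewrite /= sum0 => /lt_trans; apply.
- by have := near true [ffun=> false]; rewrite /= eqxx sum0 => /lt_trans; apply.
move=> e e0 /=; have := near false e; have := near true e.
rewrite (negbTE e0) /= => h1; rewrite metric_sym => h2.
by rewrite (le_lt_trans (metric_triangle _ x _))// (splitr d) ltrD.
Qed.
End FaceElements.

(* Baire category: w avoids the boundaries, relative to Q, of all the L i. *)
Lemma generic_point (M : topologicalType) (Q : set M) (K : countType)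
    (L : K -> set M) :
  regular_space M -> compact Q -> Q !=set0 -> (forall i, open (L i)) ->
  exists2 w, Q w & forall i, closure (Q `&` L i) w -> L i w.
Proof.
move=> rM cQ Q0 oL.
pose good U := open U /\ Q `&` U !=set0.
(* Passing to U' settles the index [i]. The premise [good U] stands under the existential so that
   [choice] gives a total function; [setT] is the default value. *)
have shrink (i : K) U : exists U', good U -> [/\ good U',
    closure U' `<=` U &
    closure U' `<=` L i \/ Q `&` U `&` L i = set0].
  have [gU|?] := pselect (good U); last by exists setT.
  have {gU} [oU QU] := gU.
  have shrinkO (O : set M) : open O -> Q `&` O !=set0 -> exists U',
      good U' /\ closure U' `<=` O.
    move=> oO [q [Qq Oq]].
    have [B qB BO] := rM q O (open_nbhs_nbhs (conj oO Oq)).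
    exists B°; split; last first.
      exact: subset_trans (closureS (@interior_subset _ B)) BO.
    by split; [exact: open_interior|exists q].
  have [QUL|/set0P QUL] := eqVneq (Q `&` U `&` L i) set0.
    have [U' [gU' U'U]] := shrinkO U oU QU.
    by exists U' => _; split => //; right.
  have [|U' [gU' U'U]] := shrinkO (U `&` L i) (openI oU (oL i)).
    by rewrite setIA.
  exists U' => _; split => //; first by move=> x /U'U[].
  by left => x /U'U[].
have [f fP] := choice (fun iU => shrink iU.1 iU.2).
(* Stage m + 1 settles the index coded by m, if there is one. *)
pose U_ := fix U_ n := if n is m.+1 then
  (if unpickle m is Some i then f (i, U_ m) else U_ m) else setT.
have gU n : good (U_ n).
  elim: n => [|n IH] /=; first by split; [exact: openT|rewrite setIT].
  by case: unpickle => // i; have [] := fP (i, U_ n) IH.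
have U_S n : U_ n.+1 `<=` U_ n.
  rewrite /=; case: unpickle => // i; have [_ + _] := fP (i, U_ n) (gU n).
  by apply: subset_trans; exact: subset_closure.
have U_le m n : (m <= n)%N -> U_ n `<=` U_ m.
  elim: n => [|n IH]; first by rewrite leqn0 => /eqP ->.
  rewrite leq_eqVlt => /predU1P[->//|]; rewrite ltnS => /IH.
  by apply: subset_trans; exact: U_S.
pose F := filter_from [set: nat] (fun n => Q `&` U_ n).
have PF : ProperFilter F.
  apply: filter_from_proper; last by move=> n _; have [] := gU n.
  apply: filter_from_filter; first by exists 0%N.
  move=> m n _ _; exists (maxn m n) => // w [Qw Uw].
  by split; (split => //; apply: U_le Uw); rewrite ?leq_maxl ?leq_maxr.
have FQ : F Q by exists 0%N => // w [].
have [w [Qw clw]] := cQ F PF FQ.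
have wU n : closure (U_ n) w.
  move=> B wB; have [v [[_ Uv] Bv]] : (Q `&` U_ n) `&` B !=set0.
    by apply: clw => //; exists n.
  by exists v.
(* The index [i] was settled at the stage after [pickle i]. If [L i] did not meet Q inside
   [U_ (pickle i)], this open neighbourhood of w would contradict [clL]. *)
exists w => // i clL; have := wU (pickle i).+1; rewrite /= pickleK.
have [_ sU [sL|L0]] := fP (i, U_ (pickle i)) (gU (pickle i)).
  by move=> /sL.
move=> /sU Uw; have [oU _] := gU (pickle i).
have [v [[Qv Lv] Uv]] := clL _ (open_nbhs_nbhs (conj oU Uw)).
by have : set0 v by rewrite -L0.
Qed.

(** * Cubes whose opposite faces are translates of each other *)

Section TranslationCubes.
Variables (X : topologicalType) (T : homeomorphism X).
Hypotheses (cX : compact [set: X]) (hX : hausdorff_space X).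
Hypothesis gE : composition_group (enveloping T).
Variable k : nat.
Let V := {ffun 'I_k -> bool}.

(** For [i <= k], a face of dimension [i], with [top_vertex i] opposite to 0 in it; [raise i] maps
    it to the opposite face inside [lower_face i.+1]. *)
Definition lower_face (i : nat) (e : V) :=
  [forall l : 'I_k, (i <= l)%N ==> ~~ e l].

Definition top_vertex (i : nat) : V := [ffun l : 'I_k => (l < i)%N].

Definition raise (i : 'I_k) (e : V) : V := [ffun l => (l == i) || e l].

Lemma lower_face_top i : lower_face i (top_vertex i).
Proof. by apply/forallP => l; rewrite ffunE -leqNgt; apply/implyP. Qed.

Lemma lower_faceS i e : lower_face i e -> lower_face i.+1 e.
Proof.
move=> /forallP h; apply/forallP => l; apply/implyP => /ltnW il.
by have /implyP := h l; exact.
Qed.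

Lemma lower_face_raise (i : 'I_k) e :
  lower_face i e -> lower_face i.+1 (raise i e).
Proof.
move=> /forallP h; apply/forallP => l; apply/implyP => il.
rewrite ffunE negb_or; apply/andP; split; last first.
  by have /implyP := h l; apply; exact: ltnW.
by apply: contraTneq il => ->; rewrite ltnn.
Qed.

Lemma raise_top (i : 'I_k) : raise i (top_vertex i) = top_vertex i.+1.
Proof. by apply/ffunP => l; rewrite !ffunE ltnS [RHS]leq_eqVlt. Qed.

Lemma lower_face_neq_top (i : 'I_k) e : lower_face i e -> e != top_vertex i.+1.
Proof.
move=> /forallP/(_ i); rewrite leqnn /=; apply: contraNneq => ->.
by rewrite ffunE.
Qed.

Lemma raise_neq_top (i : 'I_k) e : lower_face i e -> e != top_vertex i ->
  raise i e != top_vertex i.+1.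
Proof.
move=> /forallP/(_ i); rewrite leqnn /= => ei; apply: contra_neq => ri.
apply/ffunP => l; have /ffunP/(_ l) := ri; rewrite !ffunE ltnS.
have [->|li] := eqVneq l i; first by rewrite ltnn (negbTE ei).
by rewrite [(l < i)%N]ltn_neqAle (_ : (l : nat) != i) //.
Qed.

(* If p fixes the lower face, then the commutator of its inverse with that of
   the translation q between the two faces moves only the top of the lower
   face, and one more step down in the series. *)
Lemma translation_cube_corner (w : V -> X) i j p : (i <= k)%N ->
  (forall l : 'I_k, exists2 q : X -> X, enveloping T q &
    forall e, lower_face l e -> w (raise l e) = q (w e)) ->
  Etop T j.+1 p ->
  (forall e, lower_face i e -> e != top_vertex i -> p (w e) = w e) ->
  exists2 u, Etop T (j.+1 + i) u & p (w (top_vertex i)) = u (w (top_vertex i)).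
Proof.
move=> + wq; elim: i j p => [|i IH] j p ik Ep pw.
  by exists p; rewrite ?addn0.
have {wq} [q Eq wq] := wq (Ordinal ik).
have [EjE _ gEj _] := Etop_normal cX hX gE j.+1.
have [p' [Ep' pp' p'p]] := group_inverse gEj Ep.
have [q' [Eq' qq' q'q]] := group_inverse gE Eq.
pose c : X -> X := p' \o q' \o p \o q.
have Ec : Etop T j.+2 c by apply: Etop_comm.
have fixp e : lower_face i e -> p (w e) = w e.
  move=> ie; apply: pw; first exact: lower_faceS.
  exact: (@lower_face_neq_top (Ordinal ik)).
have [|u Eu cu] := IH j.+1 c (ltnW ik) Ec.
  move=> e ie ne; rewrite /c /= -wq // pw; last 2 first.
  - exact: (@lower_face_raise (Ordinal ik)).
  - exact: (@raise_neq_top (Ordinal ik)).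
  by rewrite wq // qq' -{1}(fixp e ie) pp'.
have [_ _ _ nEu] := Etop_normal cX hX gE (j.+1 + i.+1).
(* Write w1 for [w (top_vertex i)]. The equation c w1 = u w1 says p (q w1) = q (p (u w1)); moreover
   q' brings q w1 back to w1, which p' fixes. *)
exists (q \o (p \o u \o p') \o q').
  have Epu : Etop T (j.+1 + i.+1) (p \o u \o p').
    by apply: nEu => //; [rewrite addnS -addSn|exact: EjE].
  exact: nEu.
have w1 := lower_face_top i.
rewrite -(@raise_top (Ordinal ik)) wq //= qq' -{2}(fixp _ w1) pp' -cu /c /=.
by rewrite p'p q'q.
Qed.

End TranslationCubes.

(** The boxes generate a filter that converges to [z] in each coordinate, hence converges to [z]. *)
Lemma nbhs_ptws_box (R : realType) (V : finType) (Y : metricType R)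
    (z : {ptws V -> Y}) (B : set {ptws V -> Y}) :
  nbhs z B -> exists2 r : R, 0 < r &
    forall f : {ptws V -> Y}, (forall e, mdist (z e) (f e) < r) -> B f.
Proof.
pose F := filter_from [set r : R | 0 < r]
  (fun r => [set f : {ptws V -> Y} | forall e, mdist (z e) (f e) < r]).
have FF : Filter F.
  apply: filter_from_filter; first by exists 1; rewrite /= ltr01.
  move=> r s /= r0 s0; exists (Num.min r s); first by rewrite /= lt_min r0.
  by move=> f h; split=> e; have := h e; rewrite /= lt_min => /andP[].
suff Fz : F --> z by move=> /Fz[r r0 rB]; exists r.
apply: cvg_ptws => e A.
rewrite -metricType_numDomainType.filter_from_mdist_nbhs.
by move=> [r r0 rA]; exists r => // f /(_ e) /rA.
Qed.

(** * Generic parallelepipeds *)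

Section Converse.
Variables (R : realType) (X : metricType R) (T : homeomorphism X).
Hypotheses (cX : compact [set: X]) (minT : minimal_system T).
Hypothesis gE : composition_group (enveloping T).

Let hX : hausdorff_space X := @metric_hausdorff R X.

Lemma hpow_mdist n (x : X) (r : R) : 0 < r -> exists2 s : R, 0 < s &
  forall y, mdist x y < s -> mdist (hpow T n x) (hpow T n y) < r.
Proof.
move=> r0; have : nbhs (hpow T n x) [set y | mdist (hpow T n x) y < r].
  by rewrite -ballEmdist; exact: nbhsx_ballx.
move=> /(hpow_continuous (n:=n)); rewrite /fmap /= nbhs_simpl.
rewrite -metricType_numDomainType.filter_from_mdist_nbhs => -[s s0 sr].
by exists s.
Qed.

Lemma orbit_near (x y : X) (B : set X) : nbhs y B -> exists n, B (hpow T n x).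
Proof.
rewrite nbhsE => -[U [oU Uy] UB].
have [z [Uz [n _ nz]]] := minT x (ex_intro _ y Uy) oU.
by exists n; apply: UB; rewrite nz.
Qed.

Lemma orbit_mdist (x y : X) (r : R) : 0 < r ->
  exists n, mdist y (hpow T n x) < r.
Proof.
move=> r0; apply: (@orbit_near x y [set z | mdist y z < r]).
by rewrite -ballEmdist; exact: nbhsx_ballx.
Qed.

(** By compactness of E the points [p x] form a closed set, and it contains a dense orbit. *)
Lemma enveloping_transitive x y : exists2 p, enveloping T p & y = p x.
Proof.
suff : ((fun p : {ptws X -> X} => p x) @` enveloping T) y.
  by move=> [p]; exists p.
have : closed ((fun p : {ptws X -> X} => p x) @` enveloping T).
  apply: closed_image => //; first exact: ptws_eval_continuous.
  exact: enveloping_compact.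
apply => B /(orbit_near x)[n Bn]; exists (hpow T n x); split => //.
by exists (hpow T n) => //; apply: subset_closure; exists n.
Qed.

Variables (k : nat) (x0 : X).
Let V := {ffun 'I_k -> bool}.
Let W := {ptws V -> X}.

(** The space of dynamical cubes of X, obtained as a single orbit of the cube group; by minimality
    it contains the parallelepipeds based at every other point too. *)
Definition cube_space : set W :=
  (fun g : {ptws V -> {ptws X -> X}} => (fun e => g e x0) : W) @`
    @cube_group _ T k.

Lemma cube_space_compact : compact cube_space.
Proof.
apply: continuous_compact; last first.
  apply: (subclosed_compact (@closed_closure _ _) (compact_ptws _)) => //.
  exact: compact_ptws.
apply: continuous_subspaceT; apply: continuous_ptws => e g.
apply: (@continuous_comp _ _ _ (fun g : {ptws V -> {ptws X -> X}} => g e)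
  (fun p : {ptws X -> X} => p x0)); exact: ptws_eval_continuous.
Qed.

Lemma cube_space_parallelepiped a m (x : X) :
  cube_space (fun e => hpow T (cube_exponent a m e) x).
Proof.
have [p Ep ->] := enveloping_transitive x0 x.
exists (cube_comp (fun e => hpow T (cube_exponent a m e)) (fun=> p)) => //.
apply: cube_groupM; last exact: cube_group_diag.
by apply: subset_closure; exists a, m.
Qed.

Lemma cube_space_act g w : cube_group T g -> cube_space w ->
  cube_space (fun e => g e (w e)).
Proof.
by move=> Gg [h Gh <-]; exists (cube_comp g h) => //; exact: cube_groupM.
Qed.

Lemma cube_space_homogeneous v w : cube_space v -> cube_space w ->
  exists2 h, cube_group T h & forall e, w e = h e (v e).
Proof.
move=> [g Gg <-] [h Gh <-]; have [g' [Gg' gg']] := cube_groupV cX hX gE Gg.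
exists (cube_comp h g'); first exact: cube_groupM.
by move=> e; rewrite /cube_comp /=; have [-> _] := gg' e.
Qed.

Definition orbit_visits (imn : 'I_k.+1 * {ffun V -> int} * nat) : set W :=
  [set w | exists t, forall e, lower_face imn.1.1 e ->
    mdist (hpow T (imn.1.2 e) x0) (hpow T t (w e)) < imn.2.+1%:R^-1].

Lemma orbit_visits_open imn : open (orbit_visits imn).
Proof.
rewrite openE => w [t wt]; rewrite /interior.
suff : nbhs w [set v : W | forall e, lower_face imn.1.1 e ->
    mdist (hpow T (imn.1.2 e) x0) (hpow T t (v e)) < imn.2.+1%:R^-1].
  by apply: filterS => v vt; exists t.
apply: (filter_forall (nbhs_filter w)) => e.
have [ie|nie] := boolP (lower_face imn.1.1 e); last exact: nearW.
apply: (@filterS _ _ _ [set v : W | mdist (hpow T (imn.1.2 e) x0)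
    (hpow T t (v e)) < imn.2.+1%:R^-1]) => //.
have c : continuous (fun v : W => hpow T t (v e)).
  move=> v; apply: (@continuous_comp _ _ _ (fun v : W => v e) (hpow T t)).
    exact: ptws_eval_continuous.
  exact: hpow_continuous.
apply: (c w [set y | mdist (hpow T (imn.1.2 e) x0) y < imn.2.+1%:R^-1]).
have [r r0 rB] : exists2 r, 0 < r & forall y, mdist (hpow T t (w e)) y < r ->
    mdist (hpow T (imn.1.2 e) x0) y < imn.2.+1%:R^-1.
  exists (imn.2.+1%:R^-1 - mdist (hpow T (imn.1.2 e) x0) (hpow T t (w e))).
    by rewrite subr_gt0; exact: wt.
  move=> y; rewrite ltrBrDl; apply: le_lt_trans; exact: metric_triangle.
by rewrite -metricType_numDomainType.filter_from_mdist_nbhs; exists r.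
Qed.

(** The pair (w, z) is a limit of pairs (v, T^t v), opposite facets of a cube of dimension k + 1,
    where [z] is tested only on a face of dimension [i]. *)
Definition approached (i : nat) (w z : W) := forall r : R, 0 < r ->
  exists v t, [/\ cube_space v, forall e, mdist (w e) (v e) < r &
    forall e, lower_face i e -> mdist (z e) (hpow T t (v e)) < r].

(* The points where w |-> closure {(T^t w_e)_e : t}, with e in a lower face, is
   continuous: the sets orbit_visits come from a countable base of boxes, the
   orbit of x0 being dense. *)
Definition generic (w : W) :=
  forall imn, closure (cube_space `&` orbit_visits imn) w -> orbit_visits imn w.

Lemma generic_exists : exists2 w, cube_space w & generic w.
Proof.
apply: generic_point.
- exact: uniform_regular.
- exact: cube_space_compact.
- by eexists; apply: (cube_space_parallelepiped 0 (fun=> 0) x0).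
- exact: orbit_visits_open.
Qed.

(** Points v close to w have a translate close to z on the face, so w is in the closure of the set
    of points that visit a given box about z. Being generic, w visits the box itself, and
    compactness of E turns these visits into one [p]. *)
Lemma generic_approached (i : nat) (w z : W) : (i <= k)%N -> generic w ->
  approached i w z -> exists2 p, enveloping T p &
    forall e, lower_face i e -> z e = p (w e).
Proof.
move=> ik gw wz.
(* Filling in [z] off the face makes [z] itself the point to be found in a closed image of E. *)
pose ext (p : {ptws X -> X}) : W :=
  fun e => if lower_face i e then p (w e) else z e.
suff [p Ep pz] : (ext @` enveloping T) z.
  by exists p => // e ie; rewrite -[LHS](congr1 (@^~ e) pz) /ext ie.
have : closed (ext @` enveloping T).
  apply: closed_image; first exact: hausdorff_ptws.
    apply: continuous_ptws => e; rewrite /ext; case: lower_face => p.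
      exact: ptws_eval_continuous.
    exact: (@cst_continuous {ptws X -> X} X).
  exact: enveloping_compact.
apply => B /nbhs_ptws_box[r r0 rB].
have [n nr] : exists n : nat, n.+1%:R^-1 < r / 2.
  have r2 : 0 < r / 2 by rewrite divr_gt0.
  exists (Num.truncn (r / 2)^-1); rewrite invf_plt ?posrE//.
  by rewrite truncnS_gt.
(* Half the precision: the box is centred on the orbit of [x0] and not at [z], so the distance from
   the centre to [z] adds to that from [z] to the translate of v. *)
pose d : R := n.+1%:R^-1 / 2.
have d0 : 0 < d by rewrite divr_gt0// invr_gt0.
have [m mz] := choice (fun e => orbit_mdist x0 (z e) d0).
pose imn : 'I_k.+1 * {ffun V -> int} * nat :=
  (Ordinal (ik : (i < k.+1)%N), finfun m, n).
have [t wt] : orbit_visits imn w.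
  apply: gw => A /nbhs_ptws_box[s s0 sA].
  have ds : 0 < Num.min d s by rewrite lt_min d0.
  have [v [t [Qv wv vt]]] := wz _ ds.
  exists v; split; last first.
    by apply: sA => e; have := wv e; rewrite lt_min => /andP[].
  split => //; exists t => e ie; rewrite /= ffunE.
  rewrite (le_lt_trans (metric_triangle _ (z e) _))// [ltRHS]splitr.
  rewrite ltrD ?[mdist _ (z e)]metric_sym//.
  by have := vt e ie; rewrite lt_min => /andP[].
exists (ext (hpow T t)); split.
  by exists (hpow T t) => //; apply: subset_closure; exists t.
apply: rB => e; rewrite /ext; case: ifPn => ie; last by rewrite mdistxx.
rewrite (le_lt_trans (metric_triangle _ (hpow T (m e) x0) _))// [ltRHS]splitr.
rewrite ltrD//.
  rewrite (lt_trans (mz e))// (lt_trans _ nr)// ltr_pdivrMr//.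
  by rewrite ltr_pMr ?invr_gt0// ltr1n.
by have := wt e ie; rewrite /= ffunE => /lt_trans; apply.
Qed.

Lemma cube_space_approx w (r : R) : cube_space w -> 0 < r ->
  exists a m, forall e, mdist (w e) (hpow T (cube_exponent a m e) x0) < r.
Proof.
move=> [g Gg <-] r0; apply: (cube_group_approx
  (N := fun e => [set q : {ptws X -> X} | mdist (g e x0) (q x0) < r]) Gg) => e.
exact: nbhs_ptws_ball.
Qed.

(** On an exact parallelepiped the passage to the opposite face is T to the power [m l], and such
    parallelepipeds approximate w. *)
Lemma generic_translation (w : W) (l : 'I_k) : cube_space w -> generic w ->
  exists2 q, enveloping T q &
    forall e, lower_face l e -> w (raise l e) = q (w e).
Proof.
move=> Qw gw; apply: (@generic_approached l w (fun e => w (raise l e))) => //.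
  exact: ltnW.
move=> r r0; have [a [m wr]] := cube_space_approx Qw r0.
exists (fun e => hpow T (cube_exponent a m e) x0), (m l); split => //.
  exact: cube_space_parallelepiped.
move=> e /forallP/(_ l); rewrite leqnn /= => /negbTE el.
have -> : hpow T (m l) (hpow T (cube_exponent a m e) x0) =
    hpow T (cube_exponent a m (raise l e)) x0.
  rewrite -[LHS]/((hpow T _ \o hpow T _) x0) -hpowD /cube_exponent.
  rewrite addrCA; congr (hpow T (_ + _) x0).
  rewrite (bigD1 l)//= [RHS](bigD1 l)//= ffunE eqxx el mulr1 mulr0 add0r.
  by congr (_ + _); apply: eq_bigr => i /negbTE il; rewrite ffunE il.
exact: wr.
Qed.

Lemma hpow_vertices_mdist (r : R) (v : W) (n : V -> int) : 0 < r ->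
  exists2 s : R, 0 < s & forall u e, mdist (v e) (u e) < s ->
    mdist (hpow T (n e) (v e)) (hpow T (n e) (u e)) < r.
Proof.
move=> r0; have h e := hpow_mdist (n e) (v e) r0.
pose B e := [set s | 0 < s /\ forall y, mdist (v e) y < s ->
  mdist (hpow T (n e) (v e)) (hpow T (n e) y) < r].
have [|f fP] := @choice V R B _.
  by move=> e; have [s s0 sr] := h e; exists s.
exists (\big[Num.min/1]_e f e).
  by apply: lt_bigmin => // e _; have [] := fP e.
move=> u e ue; have [_] := fP e; apply; apply: lt_le_trans ue _.
exact: bigmin_le_cond.
Qed.

Let top : V := top_vertex k k.

(* The cube is flipped so that x0 and y, which sit at the vertex 0 in RP, move
   to the top vertex. *)
Lemma RP_approached y : RP T k (x0, y) -> exists v, [/\ cube_space v,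
  v top = x0 & approached k v (fun e => if e == top then y else v e)].
Proof.
move=> rp.
(* Some power of T nearly fixes every vertex of u but the top one, which it sends near y; v is a
   cluster point of such u as r tends to 0. *)
pose S r := [set u : W | [/\ cube_space u, mdist x0 (u top) < r & exists t,
  mdist y (hpow T t (u top)) < r /\
  forall e, e != top -> mdist (u e) (hpow T t (u e)) < r]].
have S0 r : 0 < r -> S r !=set0.
  move=> r0; have r2 : 0 < r / 2 by rewrite divr_gt0.
  have r2r : r / 2 < r by rewrite ltr_pdivrMr// ltr_pMr// ltr1n.
  have [x' [y' [n [/= xx' yy' nr]]]] := rp _ r2.
  (* The flip: with base point the sum of n and slopes -n, the exponent at e is n paired with 1 - e,
     which vanishes at the top vertex. *)
  pose b (e : V) := cube_exponent (\sum_(l < k) n l) (fun l => - n l) e.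
  have bE e : b e = \sum_(l < k) n l * ([ffun l => ~~ e l] l)%:Z.
    rewrite /b /cube_exponent -big_split /=; apply: eq_bigr => l _.
    by rewrite ffunE; case: (e l); rewrite ?mulr1 ?mulr0 ?subrr ?addr0.
  have btop : b top = 0.
    by rewrite bE big1// => l _; rewrite !ffunE ltn_ord mulr0.
  (* By minimality y' is replaced by a point T^t x' of the orbit of x', so that the second cube
     becomes a translate of the first. *)
  have [s s0 sr] := @hpow_vertices_mdist (r / 2) (fun=> y') b r2.
  have [t ty'] := orbit_mdist x' y' s0.
  exists (fun e => hpow T (b e) x'); split.
  - exact: cube_space_parallelepiped.
  - by rewrite btop (lt_trans xx').
  exists t; split.
    rewrite btop /= (le_lt_trans (metric_triangle _ y' _))// [ltRHS]splitr.
    rewrite ltrD//; have := sr (fun=> hpow T t x') top ty'.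
    by rewrite btop.
  move=> e et; rewrite -[hpow T t _]/((hpow T t \o hpow T (b e)) x') hpowC /=.
  rewrite (le_lt_trans (metric_triangle _ (hpow T (b e) y') _))// [ltRHS]splitr.
  rewrite ltrD//; last exact: sr (fun=> hpow T t x') e ty'.
  rewrite bE; apply: nr; apply: contra_neq et => /ffunP e0.
  by apply/ffunP => l; have := e0 l; rewrite !ffunE ltn_ord => /negbFE.
pose F := filter_from [set r : R | 0 < r] S.
have PF : ProperFilter F.
  apply: filter_from_proper; last exact: S0.
  apply: filter_from_filter; first by exists 1; rewrite /= ltr01.
  move=> r s /= r0 s0; exists (Num.min r s); first by rewrite /= lt_min r0.
  move=> u [Qu]; rewrite lt_min => /andP[xr xs] [t []].
  rewrite lt_min => /andP[yr ys] ut.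
  split; split=> //; exists t; split=> // e et;
    by have := ut e et; rewrite lt_min => /andP[].
have FQ : F cube_space by exists 1; [rewrite /= ltr01|move=> u []].
have [v [Qv clv]] := cube_space_compact PF FQ.
have near r : 0 < r -> exists2 u, S r u & forall e, mdist (v e) (u e) < r.
  move=> r0; have [||u [Su vu]] :=
    clv (S r) [set u : W | forall e, mdist (v e) (u e) < r] _ _.
  - by exists r.
  - apply: (filter_forall (nbhs_filter v)) => e.
    apply: (@ptws_eval_continuous V X e v [set y | mdist (v e) y < r]).
    by rewrite -ballEmdist; exact: nbhsx_ballx.
  by exists u.
exists v; split => //.
  apply/esym/mdist_positivity/eqP; rewrite eq_le mdist_ge0 andbT.
  apply/ler_addgt0Pl => r r0; rewrite addr0 ltW//.
  have r2 : 0 < r / 2 by rewrite divr_gt0.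
  have [u [_ xu _] vu] := near _ r2.
  rewrite (le_lt_trans (metric_triangle _ (u top) _))// [ltRHS]splitr.
  by rewrite ltrD// metric_sym.
move=> r r0; have r2 : 0 < r / 2 by rewrite divr_gt0.
have r2r : r / 2 < r by rewrite ltr_pdivrMr// ltr_pMr// ltr1n.
have [u [Qu _ [t [yt ut]]] vu] := near _ r2.
exists u, t; split => // [e|e _]; first exact: lt_trans (vu e) r2r.
have [->|et] := eqVneq e top; first exact: lt_trans yt r2r.
rewrite (le_lt_trans (metric_triangle _ (u e) _))// [ltRHS]splitr.
by rewrite ltrD// ut.
Qed.

Lemma RP_Etop y : RP T k (x0, y) -> exists2 p, Etop T k.+1 p & y = p x0.
Proof.
move=> /RP_approached[v [Qv vtop vz]]; have [w Qw gw] := generic_exists.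
have [h Gh wh] := cube_space_homogeneous Qv Qw.
pose z e := h e (if e == top then y else v e).
have wz : approached k w z.
  move=> r r0; have r2 : 0 < r / 2 by rewrite divr_gt0.
  pose v' e := if e == top then y else v e.
  (* The maps [h e] need not be continuous. They are replaced by powers of T, which commute with
     T^t, close to them at both [v] and [v']. *)
  have [a [m am]] := cube_group_approx
    (N := fun e =>
      [set q : {ptws X -> X} | mdist (h e (v e)) (q (v e)) < r / 2] `&`
      [set q : {ptws X -> X} | mdist (h e (v' e)) (q (v' e)) < r / 2])
    Gh (fun e => filterI (nbhs_ptws_ball _ _ r2) (nbhs_ptws_ball _ _ r2)).
  pose c := cube_exponent a m.
  have [s s0 sr] := hpow_vertices_mdist v c r2.
  have [s' s'0 s'r] := hpow_vertices_mdist v' c r2.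
  have ss' : 0 < Num.min s s' by rewrite lt_min s0.
  have [u [t [Qu vu zu]]] := vz _ ss'.
  exists (fun e => hpow T (c e) (u e)), t; split.
  - apply: (@cube_space_act (fun e => hpow T (c e))) => //.
    by apply: subset_closure; exists a, m.
  - move=> e; rewrite wh.
    rewrite (le_lt_trans (metric_triangle _ (hpow T (c e) (v e)) _))//.
    rewrite [ltRHS]splitr ltrD//; first by have [] := am e.
    by apply: sr; have := vu e; rewrite lt_min => /andP[].
  - move=> e ie.
    rewrite -[hpow T t _]/((hpow T t \o hpow T (c e)) (u e)) hpowC /=.
    rewrite (le_lt_trans (metric_triangle _ (hpow T (c e) (v' e)) _))//.
    rewrite [ltRHS]splitr ltrD//; first by have [] := am e.
    apply: (s'r (fun e => hpow T t (u e))).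
    by have := zu e ie; rewrite lt_min => /andP[].
have [p Ep pz] := generic_approached (leqnn k) gw wz.
have all_lower e : @lower_face k k e.
  by apply/forallP => l; rewrite leqNgt ltn_ord.
(* Here j = 0, as p lies in E, which is [Etop T 1]; the face of dimension k is the whole cube, on
   which z and w can differ at the top vertex only. *)
have [|u Eu pu] := @translation_cube_corner X T cX hX gE k w k 0 p (leqnn k)
  (fun l => generic_translation l Qw gw) Ep.
  by move=> e _ /negbTE et; rewrite -pz// /z et wh.
(* With h taken at the top vertex, p sends h x0 to h y, so h y = u (h x0); normality absorbs the
   conjugation by h. *)
have [_ _ _ nE] := Etop_normal cX hX gE k.+1.
have [q' [Eq' qq' q'q]] := group_inverse gE (cube_group_coord (e := top) Gh).
exists (q' \o u \o h top); first by apply: nE => //; rewrite add1n in Eu.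
move: pu; rewrite -/top -pz// /z eqxx wh vtop => /(congr1 q').
by rewrite qq'.
Qed.
End Converse.

Theorem theorem1p4 (R : realType) (X : metricType R) (T : homeomorphism X)
    (d : nat) :
  compact [set: X] -> minimal_system T -> top_nilpotent_group T d ->
  forall (k : nat) (x y : X), (1 <= k <= d)%N ->
    RP T k (x, y) <-> (exists2 p : X -> X, Etop T k.+1 p & y = p x).
Proof.
move=> cX minT [gE _] k x y _; split; first exact: RP_Etop.
by move=> [p Ep ->]; exact: Etop_RP.
Qed.
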